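(* For the scheduling game on $m$ uniform machines under the EQUI policy, both the price of anarchy and the strong price of anarchy are $\Theta(\log m)$.
   Context: Uniform machines: each job $i$ has length $p_i>0$, each machine $j$ has speed $s_j>0$, and the processing time of $i$ on $j$ is $p_{i,j}=p_i/s_j$. A strategy profile $\sigma$ maps jobs to machines; the load of machine $j$ is $\sum_{i:\sigma(i)=j}p_{i,j}$, the makespan is the maximum load, and $\mathrm{OPT}$ is the minimum makespan over all profiles. Under EQUI the cost of job $i$ with $\sigma(i)=j$ is $c_i=\sum_{i':\sigma(i')=j}\min\{p_{i,j},p_{i',j}\}$ (the sum includes $i$). Nash equilibrium: no job can strictly decrease its cost by a unilateral move; strong Nash equilibrium: no nonempty coalition can move simultaneously so that every member strictly decreases its cost. The (strong) price of anarchy for $m$ machines is the supremum over instances with $m$ machines of (largest makespan of a (strong) Nash equilibrium)/$\mathrm{OPT}$; the claim is that it is bounded above and below by constant multiples of $\log m$. *)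

(* Defs.v *)
From HB Require Import structures.
From mathcomp Require Import all_boot all_order all_algebra.
From mathcomp Require Import all_classical all_reals all_analysis.

Set Implicit Arguments.
Unset Strict Implicit.
Unset Printing Implicit Defensive.
Import Order.TTheory GRing.Theory Num.Theory.
Local Open Scope classical_set_scope.
Local Open Scope ring_scope.

(* There is at least one job: otherwise OPT = 0 and the ratio makespan / OPT
   is not defined. *)
Record uniform_instance (R : realType) (m : nat) := UniformInstance {
  njobs : nat;
  len : 'I_njobs -> R;
  speed : 'I_m -> R;
  njobs_gt0 : (0 < njobs)%N;
  len_gt0 : forall i, 0 < len i;
  speed_gt0 : forall j, 0 < speed j
}.

Section Game.
Variables (R : realType) (m : nat) (G : uniform_instance R m).

Definition profile := {ffun 'I_(njobs G) -> 'I_m}.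

Definition ptime (i : 'I_(njobs G)) (j : 'I_m) : R := len i / speed G j.

Definition load (sigma : profile) (j : 'I_m) : R :=
  \sum_(i | sigma i == j) ptime i j.

(* Loads are nonnegative, so the seed 0 does not change the maximum. *)
Definition makespan (sigma : profile) : R :=
  \big[Num.max/0]_(j < m) load sigma j.

(* When 0 < m, profiles form a nonempty finite type, so this infimum is a
   minimum (OPT_min below). *)
Definition OPT : R := inf (range makespan).

Definition equi_cost (sigma : profile) (i : 'I_(njobs G)) : R :=
  \sum_(i' | sigma i' == sigma i)
    Num.min (ptime i (sigma i)) (ptime i' (sigma i)).

Definition move (sigma : profile) (i : 'I_(njobs G)) (j : 'I_m) : profile :=
  [ffun k => if k == i then j else sigma k].

Definition nash (sigma : profile) : Prop :=
  forall i j, ~ equi_cost (move sigma i j) i < equi_cost sigma i.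

Definition strong_nash (sigma : profile) : Prop :=
  forall S : {set 'I_(njobs G)}, S != finset.set0 ->
  ~ exists tau : profile,
      (forall i, i \notin S -> tau i = sigma i) /\
      (forall i, i \in S -> equi_cost tau i < equi_cost sigma i).

(* Supremum of a finite set, hence the largest makespan of a profile in E
   (worst_makespan_max below); it is 0 if E is empty. *)
Definition worst_makespan (E : set profile) : R := sup (makespan @` E).

Lemma OPT_min : (0 < m)%N ->
  (exists sigma, OPT = makespan sigma) /\
  (forall sigma, OPT <= makespan sigma).
Proof.
move=> m0; pose s0 : profile := [ffun=> Ordinal m0].
have [s _ smin] := @arg_minP _ R _ s0 predT makespan isT.
have lbs : lbound (range makespan) (makespan s).
  by move=> _ [t _ <-]; exact: smin.
suff -> : OPT = makespan s by split=> [|t]; [exists s | exact: smin].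
apply/eqP; rewrite eq_le; apply/andP; split.
  by apply: ge_inf; [exists (makespan s) | exists s].
by apply: lb_le_inf => //; exists (makespan s), s.
Qed.

Lemma worst_makespan_max (E : set profile) : E !=set0 ->
  (exists2 sigma, E sigma & worst_makespan E = makespan sigma) /\
  (forall sigma, E sigma -> makespan sigma <= worst_makespan E).
Proof.
case=> s0 Es0; have Es0' : `[< E s0 >] by apply/asboolP.
have [s /asboolP Es smax] := @arg_maxP _ R _ s0 (fun t => `[< E t >]) makespan Es0'.
have ubs : ubound (makespan @` E) (makespan s).
  by move=> _ [t Et <-]; apply: smax; apply/asboolP.
suff -> : worst_makespan E = makespan s.
  by split=> [|t Et]; [exists s | apply: smax; apply/asboolP].
apply/eqP; rewrite eq_le; apply/andP; split.
  by apply: ge_sup => //; exists (makespan s), s.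
by apply: ub_le_sup; [exists (makespan s) | exists s].
Qed.

End Game.

(* An instance without any equilibrium would contribute the ratio 0; for
   0 < m this does not affect the supremum, since a one-job instance has a
   (strong) equilibrium, of ratio 1. *)
Definition price_of_anarchy (R : realType) (m : nat) : \bar R :=
  ereal_sup (range (fun G : uniform_instance R m =>
    (worst_makespan (@nash R m G) / OPT G)%:E)).

Definition strong_price_of_anarchy (R : realType) (m : nat) : \bar R :=
  ereal_sup (range (fun G : uniform_instance R m =>
    (worst_makespan (@strong_nash R m G) / OPT G)%:E)).

(* Main.v *)
Require Import Defs.
From HB Require Import structures.
From mathcomp Require Import all_boot all_order all_algebra.
From mathcomp Require Import all_classical all_reals all_analysis.
From mathcomp Require Import ring lra zify.
(* Upper bound: let O be the optimal makespan and S(k) the total speed of the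
   machines j such that every machine at least as fast as j has load at least
   k O in the equilibrium. On a machine counted in S(k+3), the jobs which an
   optimal profile puts outside the machines counted in S(k) have cost at most
   (k+1) O, because they could move to a fast enough machine of load less than
   k O; hence they contribute at most (k+1) O to the load, and at least 2 O of
   it is due to jobs which the optimum runs within S(k). So 2 S(k+3) <= S(k),
   and the load of the fastest machines is O(log m) O.

   Lower bound: tier r consists of about 3 * 4^r machines of speed 2^-r, each
   running 2^u jobs of length 2^-(r+u) for all u with r + u <= K. A job would
   pay at least its own processing time more on any other machine, which makes
   the profile a strong equilibrium. Its makespan is K + 1 = Omega(log m),
   whereas running each job of length 2^-s in tier s gives makespan at most 2. *)

Set Implicit Arguments.
Unset Strict Implicit.
Unset Printing Implicit Defensive.
Import Order.TTheory GRing.Theory Num.Theory.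
Local Open Scope ring_scope.

(** * Processing times, loads and EQUI costs under unilateral moves *)

Section EquiGame.
Variables (R : realType) (m : nat) (G : uniform_instance R m).
Implicit Types (sigma tau : profile G) (i : 'I_(njobs G)) (j : 'I_m).

Lemma ptime_gt0 i j : 0 < ptime i j.
Proof. by rewrite divr_gt0 ?len_gt0 ?speed_gt0. Qed.

Lemma ptimeK i j : ptime i j * speed G j = len i.
Proof. by rewrite divfK // gt_eqF ?speed_gt0. Qed.

Lemma load_ge0 sigma j : 0 <= load sigma j.
Proof. by apply: sumr_ge0 => i _; rewrite ltW ?ptime_gt0. Qed.

Lemma load_le_makespan sigma j : load sigma j <= makespan sigma.
Proof. exact: le_bigmax. Qed.

Lemma ptime_le_load sigma i : ptime i (sigma i) <= load sigma (sigma i).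
Proof.
rewrite /load (bigD1 i) //= lerDl.
by apply: sumr_ge0 => k _; rewrite ltW ?ptime_gt0.
Qed.

Lemma makespan_gt0 sigma : 0 < makespan sigma.
Proof.
pose i : 'I_(njobs G) := Ordinal (njobs_gt0 G).
apply: (lt_le_trans (ptime_gt0 i (sigma i))).
exact: (le_trans (ptime_le_load sigma i)) (load_le_makespan _ _).
Qed.

Lemma OPT_gt0 : (0 < m)%N -> 0 < OPT G.
Proof. by move=> m0; have [[s ->] _] := OPT_min G m0; exact: makespan_gt0. Qed.

Lemma equi_cost_move sigma i j : j != sigma i ->
  equi_cost (move sigma i j) i =
  \sum_(i' | sigma i' == j) Num.min (ptime i j) (ptime i' j) + ptime i j.
Proof.
move=> ji; rewrite /equi_cost.
have -> : move sigma i j i = j by rewrite ffunE eqxx.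
rewrite (bigD1 i) /= ?ffunE ?eqxx // minxx addrC; congr (_ + _).
apply: eq_bigl => k; rewrite ffunE; case: (eqVneq k i) => [->|_].
  by rewrite andbF eq_sym (negbTE ji).
by rewrite andbT.
Qed.

Lemma equi_cost_le_load sigma i : equi_cost sigma i <= load sigma (sigma i).
Proof. by apply: ler_sum => k _; rewrite ge_min lexx orbT. Qed.

(** Each job already on [j] charges a newcomer at most its own processing time. The case
    [j = sigma i] is included: there the load alone bounds the cost. *)
Lemma nash_equi_cost_le sigma i j : nash sigma ->
  equi_cost sigma i <= load sigma j + ptime i j.
Proof.
move=> ne; have [->|ji] := eqVneq j (sigma i).
  apply: (le_trans (equi_cost_le_load _ _)).
  by rewrite lerDl ltW ?ptime_gt0.
have /negP := ne i j; rewrite -leNgt => /le_trans; apply.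
rewrite (equi_cost_move ji) lerD2r; apply: ler_sum => k _.
by rewrite ge_min lexx orbT.
Qed.

(* The longest job of [P] on [j] is charged the full length of every other
   job of [P] on [j]. *)
Lemma sum_ptime_le_equi_cost sigma j (P : pred 'I_(njobs G)) (B : R) :
  0 <= B -> (forall i, sigma i = j -> P i -> equi_cost sigma i <= B) ->
  \sum_(i | (sigma i == j) && P i) ptime i j <= B.
Proof.
move=> B0 costB; have [i0 Pi0|P0] := pickP (fun i => (sigma i == j) && P i).
  have [i /andP[/eqP ij Pi] imax] :=
    @arg_maxP _ R _ i0 (fun i => (sigma i == j) && P i) (fun i => ptime i j) Pi0.
  apply: le_trans (costB i ij Pi); rewrite /equi_cost ij.
  rewrite [leRHS](bigID P) /=; apply: ler_wpDr.
    by apply: sumr_ge0 => k _; rewrite le_min !ltW ?ptime_gt0.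
  by apply: ler_sum => k Pk; rewrite le_min lexx andbT; exact: imax.
by rewrite big_pred0.
Qed.

(** * Upper bound: doubling of total speed along load thresholds *)

Section UpperBound.
Variables (sigma tau : profile G) (O : R).
Hypotheses (nash_sigma : nash sigma) (O_gt0 : 0 < O)
  (load_tau : forall j, load tau j <= O).

(** Quantifying over [j'] gives every machine outside the set a witness that is at least as fast and
    has load below [k%:R * O]. *)
Definition fast_loaded (k : nat) : pred 'I_m := fun j =>
  [forall j', (speed G j <= speed G j') ==> (k%:R * O <= load sigma j')].

Let speedsum (k : nat) := \sum_(j | fast_loaded k j) speed G j.

Lemma ptime_opt_le i : ptime i (tau i) <= O.
Proof. exact: le_trans (ptime_le_load _ _) (load_tau _). Qed.

Lemma slow_equi_cost_le k i :
  ~~ fast_loaded k (tau i) -> equi_cost sigma i <= k.+1%:R * O.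
Proof.
move=> /forallPn[j]; rewrite negb_imply -ltNge => /andP[sj lj].
apply: (le_trans (nash_equi_cost_le i j nash_sigma)).
rewrite -natr1 mulrDl mul1r lerD ?(ltW lj) //.
apply: le_trans (ptime_opt_le i).
by rewrite ler_pM2l ?len_gt0 // lef_pV2 ?posrE ?speed_gt0.
Qed.

Lemma speedsum_double k : 2 * speedsum k.+3 <= speedsum k.
Proof.
rewrite -(ler_pM2l O_gt0).
have lo j : fast_loaded k.+3 j -> O * (2 * speed G j) <=
    \sum_(i | (sigma i == j) && fast_loaded k (tau i)) len i.
  move=> /forallP/(_ j); rewrite lexx /= => Lj.
  under eq_bigr do rewrite -(ptimeK _ j).
  rewrite -mulr_suml mulrA ler_pM2r ?speed_gt0 //.
  have := @sum_ptime_le_equi_cost sigma j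
    (fun i => ~~ fast_loaded k (tau i)) (k.+1%:R * O).
  rewrite mulr_ge0 ?ler0n ?(ltW O_gt0) //.
  move=> /(_ isT (fun i _ => @slow_equi_cost_le k i)).
  move: Lj; rewrite {1}/load (bigID (fun i => fast_loaded k (tau i))) /=.
  rewrite -[k.+3]addn2 natrD -[k.+1]addn1 natrD; nra.
(* Within time [O], [tau] processes on a machine at most a length of [O] times its speed. *)
have hi : \sum_(i | fast_loaded k (tau i)) len i <= O * speedsum k.
  rewrite /speedsum mulr_sumr.
  rewrite (partition_big tau (fast_loaded k)) //=; apply: ler_sum => j Aj.
  apply: le_trans (_ : load tau j * speed G j <= _); last first.
    by rewrite ler_pM2r ?speed_gt0.
  rewrite /load mulr_suml; under [leRHS]eq_bigr do rewrite ptimeK.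
  rewrite le_eqVlt; apply/orP; left; apply/eqP; apply: eq_bigl => i.
  by case: eqP => [->|]; rewrite ?andbT ?andbF.
apply: le_trans hi; rewrite /speedsum !mulr_sumr.
apply: le_trans (ler_sum _ lo) _.
rewrite [leRHS](bigID (fun i => fast_loaded k.+3 (sigma i))) /=.
apply: ler_wpDr; first by apply: sumr_ge0 => i _; rewrite ltW ?len_gt0.
rewrite [leRHS](partition_big sigma (fast_loaded k.+3)) /=; last by move=> i /andP[].
apply: ler_sum => j Aj; rewrite le_eqVlt; apply/orP; left; apply/eqP.
apply: eq_bigl => i; case: eqP => [->|]; rewrite ?andbT ?andbF //=.
by rewrite Aj andbT.
Qed.

Lemma speedsum_pow t : 2 ^+ t * speedsum (3 * t) <= speedsum 0.
Proof.
elim: t => [|t IH]; first by rewrite mul1r.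
apply: le_trans IH; rewrite exprSr -mulrA ler_pM2l ?exprn_gt0 //.
by rewrite mulnS addnC addn3 speedsum_double.
Qed.

(** Any job could move to [j0], where it takes no longer than on its machine under [tau], hence at
    most [O]. So all costs obey the bound, and the costs on [j] bound its load. *)
Lemma load_le_fastest j j0 : (forall j', speed G j' <= speed G j0) ->
  load sigma j <= load sigma j0 + O.
Proof.
move=> fast; have := @sum_ptime_le_equi_cost sigma j predT (load sigma j0 + O).
under eq_bigl do rewrite andbT; apply.
  by rewrite addr_ge0 ?load_ge0 ?(ltW O_gt0).
move=> i _ _; apply: (le_trans (nash_equi_cost_le i j0 nash_sigma)).
rewrite lerD2l; apply: le_trans (ptime_opt_le i).
by rewrite ler_pM2l ?len_gt0 // lef_pV2 ?posrE ?speed_gt0.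
Qed.

(** The extra [O] pays for [load_le_fastest], which leaves load at least 3 t O on every fastest
    machine. So [speedsum (3 * t)] is at least the top speed, while [speedsum 0] is at most [m]
    times it. *)
Lemma pow2_le_machines t j : (3 * t + 1)%:R * O <= load sigma j -> (2 ^ t <= m)%N.
Proof.
move=> Lj; have [j0 _ fast] := @arg_maxP _ R _ j predT (speed G) isT.
have Aj0 : fast_loaded (3 * t) j0.
  apply/forallP => j'; apply/implyP => sj'.
  have := @load_le_fastest j j' (fun j1 => le_trans (fast j1 isT) sj').
  by move: Lj; rewrite natrD mulrDl mul1r; lra.
have lo : speed G j0 <= speedsum (3 * t).
  rewrite /speedsum (bigD1 j0) //= lerDl.
  by apply: sumr_ge0 => k _; rewrite ltW ?speed_gt0.
have hi : speedsum 0 <= m%:R * speed G j0.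
  rewrite mulr_natl -[m in _ *+ m]card_ord -sumr_const.
  rewrite /speedsum big_mkcond; apply: ler_sum => k _.
  by case: ifP => _; [exact: fast | rewrite ltW ?speed_gt0].
rewrite -(ler_nat R) natrX -(ler_pM2r (speed_gt0 G j0)).
apply: le_trans hi; apply: le_trans (speedsum_pow t).
by rewrite ler_pM2l ?exprn_gt0.
Qed.

End UpperBound.

Lemma nash_makespan_le sigma : (1 < m)%N -> nash sigma ->
  makespan sigma <= 7 / ln 2 * ln m%:R * OPT G.
Proof.
move=> m1 ne; have m0 := ltnW m1; have O0 := OPT_gt0 m0.
have [[tau Otau] _] := OPT_min G m0.
have ln20 : 0 < ln 2 :> R by rewrite ln_gt0 // ltr1n.
have lnm : ln 2 <= ln m%:R :> R by rewrite ler_ln ?posrE ?ltr0n // ler_nat.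
have lm1 : 1 <= ln m%:R / ln 2 :> R by rewrite ler_pdivlMr ?mul1r.
set x := ln m%:R / ln 2 in lm1.
have -> : 7 / ln 2 * ln m%:R = 7 * x :> R by rewrite /x mulrAC mulrA.
apply: bigmax_le => [|j _]; first by have := O0; nra.
set L := load sigma j; set O := OPT G in O0 Otau *.
have [LO|OL] := ltP L O; first by nra.
(* [y] solves L = (3 y + 1) O. Its integer part is at most x, the binary logarithm of [m], so 3 y +
   1 < 3 x + 4 <= 7 x, as x >= 1. *)
set y := (L / O - 1) / 3.
have y0 : 0 <= y by rewrite /y divr_ge0 // subr_ge0 ler_pdivlMr ?mul1r.
have LE : L = (3 * y + 1) * O.
  by rewrite /y mulrC [3 * _]mulrC divfK // subrK mulrC divfK // gt_eqF.
have /andP[ty yt] := truncn_itv y0; set t := Num.truncn y in ty yt.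
have tm : (2 ^ t <= m)%N.
  apply: (@pow2_le_machines sigma tau O ne O0 _ t j).
    by move=> j'; rewrite Otau load_le_makespan.
  by rewrite -/L LE natrD natrM ler_pM2r // lerD2r ler_pM2l.
have tx : t%:R <= x.
  rewrite /x ler_pdivlMr // mulr_natl -lnXn // -natrX ler_ln ?posrE ?ltr0n //.
    by rewrite ler_nat.
  by rewrite expn_gt0.
rewrite LE ler_pM2r //; move: yt; rewrite -natr1; lra.
Qed.

(** * Strong equilibria from a cost margin *)

Lemma strong_nash_nash sigma : strong_nash sigma -> nash sigma.
Proof.
move=> sn i j lt; have := sn (finset.set1 i).
rewrite -card_gt0 cards1 => /(_ isT); apply; exists (move sigma i j); split=> k.
  by rewrite finset.in_set1 /move ffunE => /negbTE ->.
by rewrite finset.in_set1 => /eqP ->.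
Qed.

(* Weighing a swap by the least length of an arriving job shows that no machine
   receives more jobs than it loses, hence all receive as many as they lose;
   then every departing job has a larger home processing time than some
   arriving one, which is absurd for the departing job minimising it. *)
Lemma margin_strong_nash sigma :
  (forall i j, j != sigma i ->
     equi_cost sigma i + ptime i (sigma i) <= equi_cost (move sigma i j) i) ->
  strong_nash sigma.
Proof.
move=> margin S S0 [tau [tauN tauS]].
pose moved i := tau i != sigma i.
pose ins j := [pred i | moved i && (tau i == j)].
pose outs j := [pred i | moved i && (sigma i == j)].
have movedS i : moved i -> i \in S.
  by apply: contraR => /tauN/eqP ts; rewrite /moved ts.
(* For the shortest arrival [i], every arrival charges exactly [ptime i j]; its strict gain under
   [tau] is played against the margin for moving alone. *)
have key j i : i \in ins j ->
    (forall k, k \in ins j -> ptime i j <= ptime k j) ->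
    (#|ins j|%:R - 1) * ptime i j + ptime i (sigma i) <
    \sum_(k in outs j) Num.min (ptime i j) (ptime k j).
  move=> /andP[mi /eqP tij] imin.
  have := margin i j; rewrite -{1}tij => /(_ mi).
  rewrite equi_cost_move; last by rewrite -tij.
  have := tauS _ (movedS _ mi).
  rewrite {1}/equi_cost tij; pose mu (k : 'I_(njobs G)) := Num.min (ptime i j) (ptime k j).
  have insE : \sum_(k in ins j) mu k = #|ins j|%:R * ptime i j.
    rewrite mulr_natl -sumr_const; apply: eq_bigr => k /imin pk.
    exact/min_idPl.
  have bal : \sum_(k | tau k == j) mu k + \sum_(k in outs j) mu k =
             \sum_(k | sigma k == j) mu k + \sum_(k in ins j) mu k.
    rewrite !(big_mkcond (fun k => _ == j)) ![\sum_(k in _) _]big_mkcond -!big_split /=.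
    apply: eq_bigr => k _; rewrite !inE /moved.
    have [->|_] := eqVneq (tau k) (sigma k); first by [].
    by rewrite /= addrC.
  by move: insE bal; rewrite /mu; lra.
have le_in j : (#|ins j| <= #|outs j|)%N.
  have [i0 ini0|in0] := pickP (ins j); last by rewrite eq_card0.
  have [i ini imin] := @arg_minP _ R _ i0 (ins j) (fun i => ptime i j) ini0.
  have := key j i ini imin; rewrite leqNgt; apply: contraTN => lt.
  rewrite -leNgt.
  apply: (@le_trans _ _ (#|outs j|%:R * ptime i j)).
    by rewrite mulr_natl -sumr_const; apply: ler_sum => k _; rewrite ge_min lexx.
  apply: ler_wpDr; first by rewrite ltW ?ptime_gt0.
  by rewrite ler_pM2r ?ptime_gt0 // lerBrDr natr1 ler_nat.
have eq_in j : #|ins j| = #|outs j|.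
  have sums (f : profile G) :
      (\sum_j #|[pred i | moved i && (f i == j)]| = #|moved|)%N.
    rewrite -sum1_card (partition_big f predT) //=.
    by apply: eq_bigr => k _; rewrite -sum1_card.
  have [_ /esym] := leqif_sum (fun j (_ : true) => leqif_eq (le_in j)).
  by rewrite !sums eqxx => /forall_inP/(_ j isT)/eqP.
have down j y : y \in outs j ->
    exists2 i, moved i & ptime i (sigma i) < ptime y (sigma y).
  move=> outy; have : (0 < #|ins j|)%N by rewrite eq_in; apply/card_gt0P; exists y.
  move=> /card_gt0P[i0 ini0].
  have [i ini imin] := @arg_minP _ R _ i0 (ins j) (fun i => ptime i j) ini0.
  exists i; first by case/andP: ini.
  have := key j i ini imin; rewrite eq_in (bigD1 y) //= => lt.
  have /andP[_ /eqP ->] := outy.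
  have le1 : Num.min (ptime i j) (ptime y j) <= ptime y j by rewrite ge_min lexx orbT.
  (* The departures other than [y] are absorbed by the multiple of [ptime i j] in [key], so [y]
     alone must exceed the home time of [i]. *)
  have : \sum_(k in outs j | k != y) Num.min (ptime i j) (ptime k j) <=
         (#|outs j|%:R - 1) * ptime i j.
    have -> : #|outs j|%:R - 1 = #|[pred k in outs j | k != y]|%:R :> R.
      rewrite (cardD1 y) outy add1n -natr1 addrK; congr _%:R.
      by apply: eq_card => k; rewrite !inE andbC.
    rewrite mulr_natl -sumr_const; apply: ler_sum => k _; by rewrite ge_min lexx.
  by move: lt le1; lra.
have [i0 mi0|m0] := pickP moved.
  have [y my ymin] := @arg_minP _ R _ i0 moved (fun i => ptime i (sigma i)) mi0.
  have [|i mi] := down (sigma y) y; first by rewrite !inE my eqxx.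
  by rewrite ltNge => /negP; apply; exact: ymin.
have [i iS] := set0Pn _ S0.
have ts : tau = sigma by apply/ffunP => k; apply/eqP; have /negbFE := m0 k.
by have := tauS i iS; rewrite ts ltxx.
Qed.
End EquiGame.

(** * EQUI charges between dyadic levels *)

Section Dyadic.
Variable R : realType.

Lemma sum_dyadic_below d : \sum_(u < d) 2 ^+ u / 2 ^+ d + (2 ^+ d)^-1 = 1 :> R.
Proof.
have -> : \sum_(u < d) 2 ^+ u / 2 ^+ d = (2 ^+ d - 1) / 2 ^+ d :> R.
  rewrite -mulr_suml; congr (_ / _).
  elim: d => [|d IH]; first by rewrite big_ord0 expr0 subrr.
  by rewrite big_ord_recr /= IH exprS; ring.
by rewrite -[X in _ + X]mul1r -mulrDl subrK divff // expf_neq0.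
Qed.

(* The summands are the charges of the [2 ^ u] jobs of level [q + u] to a job of
   level [t] on a machine of tier [q]. *)
Definition level_charge (K q t : nat) : R :=
  \sum_(u < K.+1 - q)
    Num.min (2 ^+ q / 2 ^+ t) (2 ^+ q / 2 ^+ (q + u)) *+ 2 ^ u.

Lemma level_chargeE K q t : level_charge K q t =
  \sum_(u < K.+1 - q) Num.min (2 ^+ u * (2 ^+ q / 2 ^+ t)) 1.
Proof.
apply: eq_bigr => u _; rewrite -[LHS]mulr_natl natrX.
rewrite minr_pMr ?exprn_ge0 //; congr (Num.min _ _).
by rewrite exprD; field; rewrite !expf_neq0.
Qed.

(** Each level from t to K charges 1. The levels below t charge a geometric sum that the added
    processing time completes to 1. The total does not depend on q. *)
Lemma level_charge_home K q t : (q <= t <= K)%N ->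
  level_charge K q t + 2 ^+ q / 2 ^+ t = (K - t).+2%:R.
Proof.
move=> /andP[qt tK]; rewrite level_chargeE.
have -> : t = (q + (t - q))%N by lia.
set d := (t - q)%N; have -> : (K.+1 - q)%N = (d + (K - t).+1)%N by lia.
have -> : 2 ^+ q / 2 ^+ (q + d) = (2 ^+ d)^-1 :> R.
  by rewrite exprD; field; rewrite !expf_neq0.
rewrite big_split_ord /=.
have -> : \sum_(u < d) Num.min (2 ^+ u * (2 ^+ d)^-1) 1 =
          \sum_(u < d) 2 ^+ u / 2 ^+ d :> R.
  apply: eq_bigr => u _; apply/min_idPl.
  rewrite ler_pdivrMr ?exprn_gt0 // mul1r ler_eXn2l ?ltr1n //; exact: ltnW.
have -> : \sum_(u < (K - t).+1) Num.min (2 ^+ (d + u) * (2 ^+ d)^-1) 1 =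
          (K - t).+1%:R :> R.
  rewrite -[in RHS](card_ord (K - t).+1) -sumr_const; apply: eq_bigr => u _.
  apply/min_idPr; rewrite exprD mulrC mulKf ?expf_neq0 //.
  by rewrite exprn_ege1 // ler1n.
have -> : (K - (q + d) = K - t)%N by lia.
by rewrite addrAC sum_dyadic_below nat1r.
Qed.

(** For q = t + d with d > 0, d levels fewer than K + 1 - t charge 1 each, but the processing time
    2^d >= d + 1 makes up for them. *)
Lemma level_charge_ge K q t : (q <= K)%N -> (t <= K)%N ->
  (K - t).+2%:R <= level_charge K q t + 2 ^+ q / 2 ^+ t.
Proof.
move=> qK tK; have [qt|tq] := leqP q t; first by rewrite level_charge_home ?qt.
rewrite level_chargeE.
have -> : q = (t + (q - t))%N by lia.
set d := (q - t)%N.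
have -> : 2 ^+ (t + d) / 2 ^+ t = 2 ^+ d :> R.
  by rewrite exprD mulrC mulKf ?expf_neq0.
have -> : \sum_(u < K.+1 - (t + d)) Num.min (2 ^+ u * 2 ^+ d) 1 =
          (K.+1 - (t + d))%:R :> R.
  rewrite -[in RHS](card_ord (K.+1 - (t + d))) -sumr_const.
  apply: eq_bigr => u _.
  by apply/min_idPr; rewrite -exprD exprn_ege1 // ler1n.
rewrite -natrX -natrD ler_nat.
have := ltn_expl d (isT : (1 < 2)%N); lia.
Qed.

End Dyadic.

(** * Counting tools for tiers of size 3 * 4^s *)

Lemma leq_sum_nat_subrange (F : nat -> nat) (P : pred nat) a b c d :
  (a <= b)%N -> (b <= c)%N -> (c <= d)%N ->
  (forall i, (b <= i < c)%N -> P i) ->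
  (\sum_(b <= i < c) F i <= \sum_(a <= i < d | P i) F i)%N.
Proof.
move=> ab bc cd bcP.
rewrite (big_cat_nat ab (leq_trans bc cd)) (big_cat_nat bc cd) /=.
rewrite addnCA [X in (_ <= X + _)%N]big_nat_cond [X in (X <= _)%N]big_nat_cond.
rewrite -[X in (X <= _)%N]addn0 leq_add // leq_eqVlt; apply/orP; left; apply/eqP.
by apply: eq_bigl => i; rewrite andbT; case: (boolP (_ && _)) => // /bcP ->.
Qed.

(** This will count the jobs of level s with home in a lower tier, machines being numbered from 1.
    From s to s + 1 the old terms double and 3 * 4^s new terms equal to 2 appear. *)
Lemma sum_pow_trunc_log s :
  (\sum_(1 <= a < 4 ^ s) 2 ^ (s - trunc_log 4 a) <= 3 * 4 ^ s)%N.
Proof.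
elim: s => [|s IH]; first by rewrite big_geq.
rewrite (@big_cat_nat _ _ _ (4 ^ s)) ?expn_gt0 ?leq_exp2l //=.
have -> : (\sum_(1 <= a < 4 ^ s) 2 ^ (s.+1 - trunc_log 4 a) =
           2 * \sum_(1 <= a < 4 ^ s) 2 ^ (s - trunc_log 4 a))%N.
  rewrite big_distrr /=; apply: eq_big_nat => a /andP[a0 as_].
  rewrite subSn ?expnS // -ltnS -(@ltn_exp2l 4) //.
  apply: (@leq_trans a.+1); first by rewrite ltnS trunc_logP.
  by rewrite (leq_trans as_) // leq_exp2l.
have -> : (\sum_(4 ^ s <= a < 4 ^ s.+1) 2 ^ (s.+1 - trunc_log 4 a) = 6 * 4 ^ s)%N.
  rewrite (@eq_big_nat _ _ _ _ _ _ (fun=> 2%N)); last first.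
    by move=> a /(@trunc_log_eq 4 _ _ isT) ->; rewrite subSnn.
  by rewrite sum_nat_const_nat expnS; lia.
rewrite expnS; lia.
Qed.

(** Two defaults are allowed because [spread] uses the home of each job as its default. *)
Lemma nth_index_inj (T U : eqType) (s : seq T) (r : seq U) (a b z : T) x y :
  uniq s -> x \in r -> y \in r ->
  (index x r < size s)%N -> (index y r < size s)%N ->
  nth a s (index x r) = z -> nth b s (index y r) = z -> x = y.
Proof.
move=> us xr yr sx sy <-; rewrite (set_nth_default a b sy) => /eqP.
by rewrite nth_uniq // => /eqP /index_inj ->.
Qed.

(** * Lower bound: the dyadic instance and its strong equilibrium *)

Section LowerBound.
Variables (R : realType) (m : nat).
Hypothesis m_gt0 : (0 < m)%N.

(* For [0 < s <= depth], tier [s] has at least [3 * 4 ^ s] machines, as many as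
   there can be jobs of level [s] with home in a lower tier. *)
Definition depth := (trunc_log 4 m.+1).-1.

(** The [minn] puts all machines left over after the lower tiers into tier [depth]. *)
Definition tier (j : 'I_m) := minn depth (trunc_log 4 j.+1).

(* A job is a triple (home machine [j], relative level [u], copy [c < 2 ^ u]). *)
Definition job : finType :=
  {j : 'I_m & {u : 'I_(depth.+1 - tier j) & 'I_(2 ^ u)}}.

Definition home (x : job) : 'I_m := tag x.
Definition rlevel (x : job) : nat := tag (tagged x).
Definition level (x : job) : nat := tier (home x) + rlevel x.

Lemma tier_le j : (tier j <= depth)%N.
Proof. exact: geq_minl. Qed.

Lemma level_le x : (level x <= depth)%N.
Proof.
have := ltn_ord (tag (tagged x)); have := tier_le (home x).
rewrite /level /rlevel /home; lia.
Qed.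

Lemma big_job {T : Type} {idx : T} {op : Monoid.com_law idx}
    (F : 'I_m -> nat -> T) :
  \big[op/idx]_(x : job) F (home x) (rlevel x) =
  \big[op/idx]_j \big[op/idx]_(u < depth.+1 - tier j)
    \big[op/idx]_(c < 2 ^ u) F j u.
Proof.
rewrite [RHS](eq_bigr (fun j => \big[op/idx]_(y : {u : 'I_(depth.+1 - tier j) &
  'I_(2 ^ u)}) F j (tag y))); last first.
  move=> j _; exact: (sig_big_dep (J := fun u : 'I_(depth.+1 - tier j) => 'I_(2 ^ u))
    predT (fun=> predT) (fun u _ => F j u)).
exact/esym/(sig_big_dep
  (J := fun j : 'I_m => {u : 'I_(depth.+1 - tier j) & 'I_(2 ^ u)})
  predT (fun=> predT) (fun j y => F j (tag y))).
Qed.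

Lemma job_gt0 : (0 < #|{: job}|)%N.
Proof.
rewrite -sum1_card (big_job (fun _ _ => 1%N)) /=.
rewrite (bigD1 (Ordinal m_gt0)) //= ltn_addr //.
have K0 : (0 < depth.+1 - tier (Ordinal m_gt0))%N.
  by rewrite subn_gt0 ltnS tier_le.
by rewrite (bigD1 (Ordinal K0)) //= ltn_addr // sum_nat_const card_ord.
Qed.

Definition dyadic_instance : uniform_instance R m :=
  @UniformInstance R m #|{: job}| (fun i => 2 ^- level (enum_val i))
    (fun j => 2 ^- tier j) job_gt0
    (fun i => ltac:(by rewrite invr_gt0 exprn_gt0))
    (fun j => ltac:(by rewrite invr_gt0 exprn_gt0)).

Definition job_profile (f : job -> 'I_m) : profile dyadic_instance :=
  [ffun i => f (enum_val i)].

Lemma dyadic_ptime (i : 'I_(njobs dyadic_instance)) j :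
  ptime i j = 2 ^+ tier j / 2 ^+ level (enum_val i).
Proof. by rewrite /ptime /= invrK mulrC. Qed.

Lemma sum_job_profile (f : job -> 'I_m) j (F : job -> R) :
  \sum_(i < njobs dyadic_instance | job_profile f i == j) F (enum_val i) =
  \sum_(x | f x == j) F x.
Proof.
rewrite (reindex (@enum_val job predT)) /=; last exact: onW_bij (enum_val_bij _).
by apply: eq_bigl => i; rewrite ffunE.
Qed.

Lemma sum_home j (F : nat -> R) :
  \sum_(x | home x == j) F (level x) =
  \sum_(u < depth.+1 - tier j) F (tier j + u)%N *+ 2 ^ u.
Proof.
rewrite big_mkcond (big_job (fun k u => if k == j then F (tier k + u)%N else 0)).
rewrite (bigD1 j) //= [X in _ + X]big1 ?addr0 => [|k /negbTE ->].
  by apply: eq_bigr => u _; rewrite eqxx sumr_const card_ord.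
by rewrite big1 // => u _; rewrite big1.
Qed.

Lemma home_charge (i : 'I_(njobs dyadic_instance)) j :
  \sum_(k | job_profile home k == j) Num.min (ptime i j) (ptime k j) =
  level_charge R depth (tier j) (level (enum_val i)).
Proof.
under eq_bigr do rewrite !dyadic_ptime.
pose charge l : R :=
  Num.min (2 ^+ tier j / 2 ^+ level (enum_val i)) (2 ^+ tier j / 2 ^+ l).
by rewrite (sum_job_profile home j (charge \o level)) (sum_home j charge).
Qed.

(** For a job of level t, home cost plus home processing time is exactly [depth] - t + 2, and no
    other machine costs less than that. *)
Lemma home_strong_nash : strong_nash (job_profile home).
Proof.
apply: margin_strong_nash => i j ji.
rewrite equi_cost_move // /equi_cost !home_charge !dyadic_ptime.
have -> : job_profile home i = home (enum_val i) by rewrite ffunE.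
rewrite level_charge_home ?level_charge_ge ?tier_le ?level_le //.
by rewrite andbT leq_addr.
Qed.

Lemma home_makespan : depth.+1%:R <= makespan (job_profile home).
Proof.
apply: le_trans (load_le_makespan _ (Ordinal m_gt0)); rewrite /load.
under eq_bigr do rewrite dyadic_ptime.
set j := Ordinal m_gt0.
rewrite (sum_job_profile home j (fun x => 2 ^+ tier j / 2 ^+ level x)).
rewrite (sum_home j (fun l => 2 ^+ tier j / 2 ^+ l)).
have -> : tier j = 0%N by rewrite /tier trunc_log1 minn0.
rewrite subn0 -[in leLHS](card_ord depth.+1) -sumr_const.
apply: ler_sum => u _; rewrite add0n expr0 mul1r -[leRHS]mulr_natr natrX.
by rewrite mulVf // expf_neq0.
Qed.

(** * A profile of makespan at most 2 for the dyadic instance *)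

Definition away s := [pred x : job | (level x == s) && (0 < rlevel x)%N].
Definition in_tier s := [pred j : 'I_m | tier j == s].

Lemma depth_pow s : (0 < s <= depth)%N -> (4 ^ s.+1 <= m.+1)%N.
Proof.
move=> /andP[s0 sK]; apply: leq_trans (trunc_logP (isT : (1 < 4)%N) (ltn0Sn m)).
rewrite leq_exp2l //; move: s0 sK; rewrite /depth; lia.
Qed.

Lemma card_in_tier s : (0 < s <= depth)%N -> (3 * 4 ^ s <= #|in_tier s|)%N.
Proof.
move=> sK; have powm := depth_pow sK; have /andP[s0 sd] := sK.
rewrite -sum1_card.
rewrite -(big_mkord (fun j => minn depth (trunc_log 4 j.+1) == s) (fun=> 1%N)).
have := @leq_sum_nat_subrange (fun=> 1%N)
  (fun a => minn depth (trunc_log 4 a) == s) 1 (4 ^ s) (4 ^ s.+1) m.+1.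
rewrite big_add1 /= sum_nat_const_nat muln1 expnS.
have -> : (4 * 4 ^ s - 4 ^ s = 3 * 4 ^ s)%N by lia.
apply=> //; rewrite -?expnS ?expn_gt0 ?leq_exp2l //.
move=> a /(@trunc_log_eq 4 _ _ isT) ->; exact/eqP/minn_idPr.
Qed.

(** A machine of tier r < s is home to 2^(s - r) jobs of level s, all of relative level s - r; other
    machines contribute nothing. *)
Lemma card_away s : (0 < s <= depth)%N -> (#|away s| <= 3 * 4 ^ s)%N.
Proof.
move=> sK; have powm := depth_pow sK; have /andP[s0 sd] := sK.
apply: leq_trans (sum_pow_trunc_log s).
rewrite -sum1_card big_mkcond /=.
rewrite (big_job (fun j u => if (tier j + u == s)%N && (0 < u)%N then 1%N else 0%N)).
apply: (@leq_trans (\sum_(j < m | trunc_log 4 j.+1 < s)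
                      2 ^ (s - trunc_log 4 j.+1))%N).
  rewrite [X in (_ <= X)%N]big_mkcond; apply: leq_sum => j _.
  pose P (u : 'I_(depth.+1 - tier j)) := (tier j + u == s)%N && (0 < u)%N.
  rewrite (eq_bigr (fun u => if P u then 2 ^ u else 0)%N); last first.
    move=> u _; rewrite sum_nat_const card_ord -/(P u).
    by case: (P u); rewrite ?muln1 ?muln0.
  rewrite -big_mkcond; have [u0 Pu0|P0] := pickP P; last by rewrite big_pred0.
  rewrite (big_pred1 u0) => [|u]; last first.
    apply/idP/eqP => [/andP[/eqP e _]|->] //.
    by apply: val_inj; move/andP: Pu0 => [/eqP e0 _] /=; lia.
  have /andP[/eqP e0 u00] := Pu0.
  have lt : (trunc_log 4 j.+1 < s)%N.
    by move: e0 u00 sd; rewrite /tier; lia.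
  have ge : tier j = trunc_log 4 j.+1 by apply/minn_idPr; lia.
  by rewrite lt -ge -e0 addKn.
rewrite -(big_mkord (fun j => trunc_log 4 j.+1 < s)%N
                    (fun j => 2 ^ (s - trunc_log 4 j.+1))%N).
rewrite -(big_add1 _ _ 0 m.+1 (fun a => trunc_log 4 a < s)%N
   (fun a => 2 ^ (s - trunc_log 4 a))%N).
have s4m : (4 ^ s <= m.+1)%N by rewrite (leq_trans _ powm) // leq_exp2l.
rewrite (@big_cat_nat _ _ _ (4 ^ s)) ?expn_gt0 //=.
rewrite [X in (_ + X)%N]big_nat_cond [X in (_ + X)%N]big_pred0 ?addn0.
  by rewrite big_mkcond; apply: leq_sum => a _; case: ifP.
move=> a; apply/negP => /andP[/andP[la _]].
by rewrite ltnNge trunc_log_max.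
Qed.

(** Jobs away from their tier are matched with its machines by rank; by [away_index] the default is
    never reached. *)
Definition spread (x : job) : 'I_m :=
  if rlevel x == 0%N then home x
  else nth (home x) (enum (in_tier (level x))) (index x (enum (away (level x)))).

Lemma away_index x : (0 < rlevel x)%N ->
  (index x (enum (away (level x))) < size (enum (in_tier (level x))))%N.
Proof.
move=> x0; have s0 : (0 < level x <= depth)%N by rewrite level_le andbT ltn_addl.
rewrite -cardE; apply: (leq_trans _ (card_in_tier s0)).
apply: (leq_trans _ (card_away s0)).
by rewrite cardE index_mem mem_enum inE eqxx.
Qed.

Lemma tier_spread x : tier (spread x) = level x.
Proof.
rewrite /spread; case: posnP => [x0|x0]; first by rewrite /level x0 addn0.
have := mem_nth (home x) (away_index x0).
by rewrite mem_enum => /eqP.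
Qed.

(** One job at most stays at home, since relative level 0 has a single copy, and the matching by
    rank sends at most one other job to [j]. *)
Lemma card_spread j : (#|[pred x | spread x == j]| <= 2)%N.
Proof.
rewrite -(cardID [pred x | rlevel x == 0%N]) -[2%N]/(1 + 1)%N leq_add //.
  apply: leq_trans (_ : #|[pred x : job | (home x == j) && (rlevel x == 0%N)]| <= _)%N.
    apply: subset_leq_card; apply/fintype.subsetP => x; rewrite !inE /spread.
    by case/andP => + x0; rewrite x0 andbT.
  rewrite -sum1_card big_mkcond /=.
  rewrite (big_job (fun k u => if (k == j) && (u == 0)%N then 1 else 0)%N).
  rewrite (bigD1 j) //= [X in (_ + X)%N]big1 ?addn0 => [|k /negbTE ->]; last first.
    by rewrite big1 // => u _; rewrite big1.
  rewrite eqxx subSn ?tier_le // big_ord_recl /= sum_nat_const card_ord muln1.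
  by rewrite big1 // => u _; rewrite big1.
apply/card_le1_eqP => x y; rewrite !inE -!lt0n.
move=> /andP[x0 /eqP xj] /andP[y0 /eqP yj].
have lxy : level x = level y by rewrite -!tier_spread xj yj.
move: xj yj (away_index x0) (away_index y0); rewrite /spread.
rewrite !gtn_eqF // -lxy => xj yj sx sy.
apply/esym; apply: (nth_index_inj (enum_uniq _) _ _ sx sy xj yj).
  by rewrite mem_enum inE eqxx.
by rewrite mem_enum inE -lxy eqxx.
Qed.

Lemma dyadic_OPT_le : OPT dyadic_instance <= 2.
Proof.
have [_ /(_ (job_profile spread)) /le_trans] := OPT_min dyadic_instance m_gt0.
apply; apply: bigmax_le => // j _; rewrite /load.
under eq_bigr do rewrite dyadic_ptime.
rewrite (sum_job_profile spread j (fun x => 2 ^+ tier j / 2 ^+ level x)).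
rewrite (eq_bigr (fun=> 1)) => [|x /eqP <-]; last first.
  by rewrite tier_spread divff // expf_neq0.
by rewrite sumr_const ler_nat card_spread.
Qed.

Lemma dyadic_ratio (E : set (profile dyadic_instance)) :
  E (job_profile home) ->
  depth.+1%:R / 2 <= worst_makespan E / OPT dyadic_instance.
Proof.
move=> Eh; have [_ /(_ _ Eh) le] := worst_makespan_max (ex_intro _ _ Eh).
rewrite ler_pM ?ler0n ?invr_ge0 ?(le_trans home_makespan le) //.
by rewrite lef_pV2 ?posrE ?dyadic_OPT_le // OPT_gt0.
Qed.

(** Here m < 4^([depth] + 2) <= 4^(2 ([depth] + 1)); the other factor 2 of the constant 4 cancels
    the bound 2 on [OPT]. *)
Lemma ln_le_depth : ln m%:R <= (4 * ln 4) * (depth.+1%:R / 2) :> R.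
Proof.
have -> : (4 * ln 4) * (depth.+1%:R / 2) = ln 4 *+ (2 * depth.+1) :> R.
  by rewrite -[RHS]mulr_natl natrM; field.
rewrite -lnXn // ler_ln ?posrE ?exprn_gt0 ?ltr0n // -natrX ler_nat.
apply: (leq_trans (leqnSn m)).
apply: (leq_trans (ltnW (@trunc_log_ltn 4 m.+1 isT))).
by rewrite leq_exp2l // /depth; lia.
Qed.

End LowerBound.

(** * Both prices at once, for equilibrium notions between strong Nash and Nash *)

Section Prices.
Variables (R : realType) (m : nat).
Hypothesis m_gt1 : (1 < m)%N.
Variable E : forall G : uniform_instance R m, set (profile G).

Let price := ereal_sup (range (fun G : uniform_instance R m =>
  (worst_makespan (E (G := G)) / OPT G)%:E)).

Lemma price_ge :
  (forall G (sigma : profile G), strong_nash sigma -> E sigma) ->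
  (((4 * ln 4)^-1 * ln (m%:R : R))%:E <= price)%E.
Proof.
move=> snE; have m0 := ltnW m_gt1.
have ln4 : 0 < ln 4 :> R by rewrite ln_gt0 // ltr1n.
apply: le_trans (ereal_sup_ubound _); last by exists (dyadic_instance R m0).
rewrite lee_fin.
apply: le_trans (dyadic_ratio (snE _ _ (@home_strong_nash R m m0))).
by rewrite mulrC ler_pdivrMr ?mulr_gt0 // mulrC ln_le_depth.
Qed.

Lemma price_le :
  (forall G (sigma : profile G), E sigma -> nash sigma) ->
  (price <= (7 / ln 2 * ln (m%:R : R))%:E)%E.
Proof.
move=> Enash; have m0 := ltnW m_gt1.
have lnm n : (1 < n)%N -> 0 < ln n%:R :> R by move=> n1; rewrite ln_gt0 // ltr1n.
apply: ge_ereal_sup => _ [G _ <-].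
rewrite lee_fin ler_pdivrMr ?OPT_gt0 //.
have [[s Es]|nE] := pselect (exists s, E (G := G) s).
  have [[s' Es' ->] _] := worst_makespan_max (ex_intro _ s Es).
  exact: nash_makespan_le (Enash _ _ Es').
(* Without equilibria, the supremum of the empty set is 0 by convention. *)
have -> : worst_makespan (E (G := G)) = 0.
  rewrite /worst_makespan (_ : E (G := G) = classical_sets.set0) ?image_set0 ?sup0 //.
  by apply/eqP/negPn/negP => /set0P.
by rewrite !mulr_ge0 ?invr_ge0 ?(ltW (OPT_gt0 _ _)) // ltW ?lnm.
Qed.

End Prices.

Theorem theorem10 (R : realType) :
  (exists c C : R, 0 < c /\ 0 < C /\
     forall m : nat, (2 <= m)%N ->
       ((c * ln (m%:R : R))%:E <= price_of_anarchy R m)%E /\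
       (price_of_anarchy R m <= (C * ln (m%:R : R))%:E)%E) /\
  (exists c C : R, 0 < c /\ 0 < C /\
     forall m : nat, (2 <= m)%N ->
       ((c * ln (m%:R : R))%:E <= strong_price_of_anarchy R m)%E /\
       (strong_price_of_anarchy R m <= (C * ln (m%:R : R))%:E)%E).
Proof.
have lnn n : (1 < n)%N -> 0 < ln n%:R :> R by move=> n1; rewrite ln_gt0 // ltr1n.
have c0 : 0 < (4 * ln 4)^-1 :> R by rewrite invr_gt0 mulr_gt0 // lnn.
have C0 : 0 < 7 / ln 2 :> R by rewrite divr_gt0 // lnn.
split; exists (4 * ln 4)^-1, (7 / ln 2); (do 2 split=> //) => m m1; split.
- by apply: price_ge => // G sigma; exact: strong_nash_nash.
- exact: price_le.
- exact: price_ge.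
- by apply: price_le => // G sigma; exact: strong_nash_nash.
Qed.
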